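(* Let $\mathfrak{g}, \mathfrak{h}$ be two Leibniz algebras and let $\mathfrak{h}$ be a Leibniz $\mathfrak{g}$-representation with actions $\rho^L,\rho^R$. Let $T: \mathfrak{h} \rightarrow \mathfrak{g}$ be a $\lambda$-weighted relative Rota-Baxter operator. Then $(\mathfrak{h}, \triangleleft, \triangleright, [~,~]^\lambda_\mathfrak{h})$ is a post-Leibniz algebra, where $$u \triangleleft v = \rho^R (u, Tv), \quad u \triangleright v = \rho^L (Tu,v) \quad \text{and} \quad [u, v]^\lambda_\mathfrak{h} = \lambda [u, v]_\mathfrak{h}, \quad \text{for } u, v \in \mathfrak{h}.$$
   Context: All vector spaces and (multi)linear maps are over a field $\mathbf{k}$ of characteristic $0$, and $\lambda \in \mathbf{k}$ is a fixed scalar. A (left) Leibniz algebra is a vector space $\mathfrak{g}$ with a bilinear bracket $[~,~]_\mathfrak{g}$ satisfying $[x,[y,z]_\mathfrak{g}]_\mathfrak{g} = [[x,y]_\mathfrak{g},z]_\mathfrak{g} + [y,[x,z]_\mathfrak{g}]_\mathfrak{g}$ for all $x,y,z$. A representation of $\mathfrak{g}$ is a vector space $V$ with bilinear maps $\rho^L : \mathfrak{g}\otimes V \to V$, $\rho^R : V \otimes \mathfrak{g} \to V$ such that for $x,y\in\mathfrak{g}$, $v \in V$: $\rho^L(x,\rho^L(y,v)) = \rho^L([x,y]_\mathfrak{g},v) + \rho^L(y,\rho^L(x,v))$; $\rho^L(x,\rho^R(v,y)) = \rho^R(\rho^L(x,v),y) + \rho^R(v,[x,y]_\mathfrak{g})$;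 $\rho^R(v,[x,y]_\mathfrak{g}) = \rho^R(\rho^R(v,x),y) + \rho^L(x,\rho^R(v,y))$. A Leibniz algebra $\mathfrak{h}$ is a Leibniz $\mathfrak{g}$-representation if it has maps $\rho^L,\rho^R$ making it a representation of $\mathfrak{g}$ and, for $u,v\in\mathfrak{h}$, $x\in\mathfrak{g}$: $[u,\rho^R(v,x)]_\mathfrak{h} = \rho^R([u,v]_\mathfrak{h},x) + [v,\rho^R(u,x)]_\mathfrak{h}$; $[u,\rho^L(x,v)]_\mathfrak{h} = [\rho^R(u,x),v]_\mathfrak{h} + \rho^L(x,[u,v]_\mathfrak{h})$; $\rho^L(x,[u,v]_\mathfrak{h}) = [\rho^L(x,u),v]_\mathfrak{h} + [u,\rho^L(x,v)]_\mathfrak{h}$. A linear map $T:\mathfrak{h}\to\mathfrak{g}$ is a $\lambda$-weighted relative Rota-Baxter operator if $[Tu,Tv]_\mathfrak{g} = T(\rho^L(Tu,v)+\rho^R(u,Tv)+\lambda[u,v]_\mathfrak{h})$ for all $u,v\in\mathfrak{h}$. A post-Leibniz algebra is a vector space $\mathfrak{a}$ with three bilinear operations $\triangleleft,\triangleright,[~,~]_\mathfrak{a}:\mathfrak{a}\otimes\mathfrak{a}\to\mathfrak{a}$ satisfying for $u,v,w\in\mathfrak{a}$, with $[u,v]_\star = u\triangleleft v+u\triangleright v+[u,v]_\mathfrak{a}$: (1) $u \triangleleft [v , w]_\star = (u \triangleleft v) \triangleleft w + v \triangleright (u \triangleleft w)$; (2) $u \triangleright (v \triangleleft w) = (u \triangleright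 v) \triangleleft w + v \triangleleft [u , w]_\star$; (3) $u \triangleright (v \triangleright w) = [u , v]_\star \triangleright w + v \triangleright (u \triangleright w)$; (4) $u \triangleright [v,w]_\mathfrak{a} = [u \triangleright v, w]_\mathfrak{a} + [ v, u \triangleright w]_\mathfrak{a}$; (5) $[u, v \triangleright w]_\mathfrak{a} = [ u \triangleleft v, w]_\mathfrak{a} + v \triangleright [u, w]_\mathfrak{a}$; (6) $[u, v \triangleleft w]_\mathfrak{a} = [u,v]_\mathfrak{a} \triangleleft w + [v, u \triangleleft w]_\mathfrak{a}$; (7) $[u, [v,w]_\mathfrak{a}]_\mathfrak{a} = [[u,v]_\mathfrak{a}, w]_\mathfrak{a} + [v, [u, w]_\mathfrak{a}]_\mathfrak{a}$. *)

(* Defs.v *)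
From mathcomp Require Import all_boot all_algebra.

Set Implicit Arguments.
Unset Strict Implicit.
Unset Printing Implicit Defensive.

Import GRing.Theory.
Local Open Scope ring_scope.

Definition is_bilinear (K : fieldType) (U V W : lmodType K) (f : U -> V -> W) :
    Prop :=
  bilinear_for *:%R *:%R f.

Record leibniz_algebra (K : fieldType) (g : lmodType K) (br : g -> g -> g) :
    Prop := LeibnizAlgebra {
  leibniz_bilinear : is_bilinear br;
  leibniz_left : forall x y z, br x (br y z) = br (br x y) z + br y (br x z)
}.

Record leibniz_rep (K : fieldType) (g V : lmodType K) (br : g -> g -> g)
    (rhoL : g -> V -> V) (rhoR : V -> g -> V) : Prop := LeibnizRep {
  rep_bilinearL : is_bilinear rhoL;
  rep_bilinearR : is_bilinear rhoR;
  rep_LL : forall x y v,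
    rhoL x (rhoL y v) = rhoL (br x y) v + rhoL y (rhoL x v);
  rep_LR : forall x y v,
    rhoL x (rhoR v y) = rhoR (rhoL x v) y + rhoR v (br x y);
  rep_RR : forall x y v,
    rhoR v (br x y) = rhoR (rhoR v x) y + rhoL x (rhoR v y)
}.

(* The brackets themselves are not required here to be Leibniz; that is the
   separate predicate leibniz_algebra. *)
Record leibniz_alg_rep (K : fieldType) (g h : lmodType K)
    (brg : g -> g -> g) (brh : h -> h -> h)
    (rhoL : g -> h -> h) (rhoR : h -> g -> h) : Prop := LeibnizAlgRep {
  alg_rep_rep : leibniz_rep brg rhoL rhoR;
  alg_rep_R : forall u v x,
    brh u (rhoR v x) = rhoR (brh u v) x + brh v (rhoR u x);
  alg_rep_RL : forall u v x,
    brh u (rhoL x v) = brh (rhoR u x) v + rhoL x (brh u v);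
  alg_rep_L : forall u v x,
    rhoL x (brh u v) = brh (rhoL x u) v + brh u (rhoL x v)
}.

Definition relative_rota_baxter (K : fieldType) (lambda : K) (g h : lmodType K)
    (brg : g -> g -> g) (brh : h -> h -> h)
    (rhoL : g -> h -> h) (rhoR : h -> g -> h) (T : {linear h -> g}) : Prop :=
  forall u v,
    brg (T u) (T v) = T (rhoL (T u) v + rhoR u (T v) + lambda *: brh u v).

Definition star_bracket (K : fieldType) (a : lmodType K)
    (tl tr br : a -> a -> a) (u v : a) : a :=
  tl u v + tr u v + br u v.

(* tl is the operation written with a left-pointing triangle, tr the one with a
   right-pointing triangle. *)
Record post_leibniz (K : fieldType) (a : lmodType K)
    (tl tr br : a -> a -> a) : Prop := PostLeibniz {
  post_bilinear_tl : is_bilinear tl;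
  post_bilinear_tr : is_bilinear tr;
  post_bilinear_br : is_bilinear br;
  post_1 : forall u v w,
    tl u (star_bracket tl tr br v w) = tl (tl u v) w + tr v (tl u w);
  post_2 : forall u v w,
    tr u (tl v w) = tl (tr u v) w + tl v (star_bracket tl tr br u w);
  post_3 : forall u v w,
    tr u (tr v w) = tr (star_bracket tl tr br u v) w + tr v (tr u w);
  post_4 : forall u v w, tr u (br v w) = br (tr u v) w + br v (tr u w);
  post_5 : forall u v w, br u (tr v w) = br (tl u v) w + tr v (br u w);
  post_6 : forall u v w, br u (tl v w) = tl (br u v) w + br v (tl u w);
  post_7 : forall u v w, br u (br v w) = br (br u v) w + br v (br u w)
}.

(* Main.v *)
Require Import Defs.
From mathcomp Require Import all_boot all_algebra.
Import GRing.Theory.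
Local Open Scope ring_scope.

(** The Rota-Baxter identity says exactly that [T] carries the star bracket of
    the three new operations to the bracket of [g] ([rota_baxter_star]). In the
    first three post-Leibniz axioms the star bracket occurs only under [T], as
    the algebra argument of an action, so there it becomes the bracket of [g]
    and the axioms are the three representation identities evaluated on the
    image of [T]. The axioms relating the actions to the bracket are the
    compatibility identities of a Leibniz [g]-representation multiplied by
    [lambda], which moves through the actions by bilinearity. The last one is
    the Leibniz identity of [h] multiplied by [lambda ^+ 2]. *)

Lemma is_bilinear_comp {K : fieldType} {U U' V V' W : lmodType K}
    {f : U -> V -> W} (S : {linear U' -> U}) (T : {linear V' -> V}) :
  is_bilinear f -> is_bilinear (fun u v => f (S u) (T v)).
Proof.
by case=> fl fr; split=> [v a u u' | u a v v'] /=; rewrite linearP ?fl ?fr.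
Qed.

Lemma is_bilinear_scale {K : fieldType} {U V W : lmodType K}
    {f : U -> V -> W} (c : K) :
  is_bilinear f -> is_bilinear (fun u v => c *: f u v).
Proof.
case=> fl fr; split=> [v a u u' | u a v v'] /=.
  by rewrite fl scalerDr !scalerA mulrC.
by rewrite fr scalerDr !scalerA mulrC.
Qed.

Lemma is_bilinearZl {K : fieldType} {U V W : lmodType K} {f : U -> V -> W}
    (fB : is_bilinear f) a u v :
  f (a *: u) v = a *: f u v.
Proof. exact: (scalable_linear (fB.1 v)). Qed.

Lemma is_bilinearZr {K : fieldType} {U V W : lmodType K} {f : U -> V -> W}
    (fB : is_bilinear f) a u v :
  f u (a *: v) = a *: f u v.
Proof. exact: (scalable_linear (fB.2 u)). Qed.

(** The two action terms come in opposite orders in the star bracket and in the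
    Rota-Baxter identity, hence the commutation. *)
Lemma rota_baxter_star {K : fieldType} {lambda : K} {g h : lmodType K}
    {brg : g -> g -> g} {brh : h -> h -> h}
    {rhoL : g -> h -> h} {rhoR : h -> g -> h} {T : {linear h -> g}}
    (rbT : relative_rota_baxter lambda brg brh rhoL rhoR T) u v :
  T (star_bracket (fun u v => rhoR u (T v)) (fun u v => rhoL (T u) v)
                  (fun u v => lambda *: brh u v) u v) = brg (T u) (T v).
Proof. by rewrite rbT /star_bracket [rhoR u _ + _]addrC. Qed.

Theorem proposition6p4 (K : fieldType) (charK0 : [pchar K] =i pred0)
  (lambda : K) (g h : lmodType K)
  (brg : g -> g -> g) (brh : h -> h -> h)
  (rhoL : g -> h -> h) (rhoR : h -> g -> h) (T : {linear h -> g})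
  (leib_g : leibniz_algebra brg) (leib_h : leibniz_algebra brh)
  (rep_h : leibniz_alg_rep brg brh rhoL rhoR)
  (rbT : relative_rota_baxter lambda brg brh rhoL rhoR T) :
  post_leibniz (fun u v => rhoR u (T v))
               (fun u v => rhoL (T u) v)
               (fun u v => lambda *: brh u v).
Proof.
case: leib_h => brhB brhJ.
case: rep_h => -[rhoLB rhoRB LL LR RR] cR cRL cL.
have starT := rota_baxter_star rbT.
split=> [|||u v w|u v w|u v w|u v w|u v w|u v w|u v w].
- exact: (is_bilinear_comp idfun T rhoRB).
- exact: (is_bilinear_comp T idfun rhoLB).
- exact: is_bilinear_scale.
- by rewrite starT RR.
- by rewrite starT LR.
- by rewrite starT LL.
- by rewrite (is_bilinearZr rhoLB) cL scalerDr.
- by rewrite (is_bilinearZr rhoLB) cRL scalerDr.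
- by rewrite (is_bilinearZl rhoRB) cR scalerDr.
- rewrite !(is_bilinearZr brhB) (is_bilinearZl brhB) brhJ.
  by rewrite !scalerDr.
Qed.
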